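(* For each integer $k\ge 2$, let $f(k):=3-\frac{3}{3k-1}$ if $k$ is even and $f(k):=3-\frac{3}{3k-2}$ if $k$ is odd. For every integer $k\ge 2$ there exists an infinite family of (pairwise non-isomorphic) graphs $G_1,G_2,\ldots$ such that $\mathrm{mad}(G_t)>f(k)$ for all $t$, $\mathrm{mad}(G_t)\to f(k)$ as $t\to\infty$, and none of the graphs $G_t$ has an $(I,F_k)$-coloring.
   Context: All graphs are finite and simple. The average degree of a graph $H$ is $2|E(H)|/|V(H)|$, and the maximum average degree $\mathrm{mad}(G)$ is the maximum of the average degree of $H$ over all (nonempty) subgraphs $H$ of $G$. An $(I,F_k)$-coloring of a graph $G$ is a partition of $V(G)$ into two sets $I$ and $F$ (possibly empty) such that $I$ is an independent set and $G[F]$ is a forest in which each component has at most $k$ vertices. *)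

(* Defs.v *)
From HB Require Import structures.
From mathcomp Require Import all_boot all_order all_algebra.
Set Implicit Arguments.
Unset Strict Implicit.
Unset Printing Implicit Defensive.
Import Order.TTheory GRing.Theory Num.Theory.
Local Open Scope ring_scope.

Record sgraph := SGraph {
  vertex :> finType;
  adj : rel vertex;
  adj_sym : symmetric adj;
  adj_irrefl : irreflexive adj
}.

Definition isomorphic (G H : sgraph) : Prop :=
  exists2 f : G -> H, bijective f & forall x y, adj (f x) (f y) = adj x y.

Definition edges (G : sgraph) : {set {set G}} :=
  [set [set p.1; p.2] | p : G * G & adj p.1 p.2].

(* A not necessarily induced subgraph, given by its vertices and its edges. *)
Definition is_subgraph (G : sgraph) (H : {set G} * {set {set G}}) : bool :=
  (H.2 \subset edges G) && [forall e in H.2, e \subset H.1].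

Definition avg_degree (R : realFieldType) (G : sgraph)
    (H : {set G} * {set {set G}}) : R :=
  2 * #|H.2|%:R / #|H.1|%:R.

(* Average degrees are nonnegative, so the default value 0 of the iterated
   maximum only matters for the graph without vertices. *)
Definition mad (R : realFieldType) (G : sgraph) : R :=
  \big[Num.max/0]_(H : {set G} * {set {set G}} |
    is_subgraph H && (H.1 != set0)) avg_degree R H.

Section Induced.
Variables (G : sgraph) (F : {set G}).

Definition induced_adj : rel {x : G | x \in F} :=
  fun x y => adj (val x) (val y).

Lemma induced_adj_sym : symmetric induced_adj.
Proof. by move=> x y; rewrite /induced_adj adj_sym. Qed.

Lemma induced_adj_irrefl : irreflexive induced_adj.
Proof. by move=> x; rewrite /induced_adj adj_irrefl. Qed.

Definition induced : sgraph := SGraph induced_adj_sym induced_adj_irrefl.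
End Induced.

Definition independent (G : sgraph) (I : {set G}) : Prop :=
  {in I &, forall x y, ~~ adj x y}.

(* [ucycle] also holds of the sequences [:: x; y] with x adjacent to y. *)
Definition forest (G : sgraph) : Prop :=
  forall c : seq G, ucycle (@adj G) c -> (size c < 3)%N.

Definition component (G : sgraph) (x : G) : {set G} :=
  [set y | connect (@adj G) x y].

Definition IF_coloring (k : nat) (G : sgraph) (I F : {set G}) : Prop :=
  [/\ I :|: F = [set: G],
      [disjoint I & F],
      independent I,
      forest (induced F) &
      forall x : induced F, (#|component x| <= k)%N].

Definition IF_colorable (k : nat) (G : sgraph) : Prop :=
  exists I F : {set G}, IF_coloring k I F.

Definition mad_bound (R : realFieldType) (k : nat) : R :=
  if odd k then 3 - 3 / (3 * k%:R - 2) else 3 - 3 / (3 * k%:R - 1).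

(* Main.v *)
Require Import Defs.
From HB Require Import structures.
From mathcomp Require Import all_boot all_order all_algebra.
From mathcomp Require Import all_classical all_reals all_analysis.
From mathcomp Require Import zify ring lra.
Set Implicit Arguments.
Unset Strict Implicit.
Unset Printing Implicit Defensive.
Import Order.TTheory GRing.Theory Num.Theory.
Import numFieldNormedType.Exports.
Local Open Scope ring_scope.

(** In an (I,F_k)-coloring, a vertex of F carrying j pendant triangles
accounts for at least j + 1 vertices of its component. Chain units made of a
triangle t, r, s and a path s, u, v, with v adjacent to the next t, and let
pendant triangles give t and s size [k./2] and r size [uphalf k]. If some v is
in F, then so is the next one: either t is in I and r, s have total size k in
one component, or t is in F, hence r is in I (as v, t, r have total size k + 1)
and v, t, s have total size at least k; in both cases u is in I. One more
triangle at the first t replaces a preceding v in F, and one more at the last s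
replaces a following u in F, so the chain is not colorable.

Each unit has exactly the critical density, which is certified by a fractional
orientation in which all vertices get the same load. The excess caused by the
two extra triangles is spread over all n units, so that the loads exceed the
critical value by at most 6 / n; this bounds the density of every subgraph. *)

(** * Fractional orientations and the maximum average degree *)

(* [w x y] is the part of the weight c of the edge xy that is given to x. *)
Section FractionalOrientation.
Variables (R : realFieldType) (G : sgraph) (w : G -> G -> R) (c : R).
Hypothesis w_sum : forall x y, adj x y -> w x y + w y x = c.

(** Double counting: each edge of [E] comes from exactly two ordered pairs, whose shares add up to
    [c]. *)
Lemma sum_shares (E : {set {set G}}) : E \subset edges G ->
  \sum_x \sum_(y | adj x y && ([set x; y]%SET \in E)) w x y = c * #|E|%:R.
Proof.
move=> /fintype.subsetP sE; rewrite pair_big_dep /=.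
rewrite (partition_big (fun p : G * G => [set p.1; p.2]%SET) (mem E)) /=; last first.
  by move=> p /andP[].
rewrite mulr_natr -sumr_const; apply: eq_bigr => e eE.
have /imsetP[[x y] /=] := sE e eE; rewrite inE /= => xy def_e.
have nxy : x != y by apply: contraTneq xy => ->; rewrite adj_irrefl.
have pairP p : (adj p.1 p.2 && ([set p.1; p.2]%SET \in E) &&
    ([set p.1; p.2]%SET == e)) = (p == (x, y)) || (p == (y, x)).
  case: p => a b /=; rewrite !xpair_eqE; apply/idP/idP => [|/orP[]/andP[/eqP-> /eqP->]].
  - case/andP=> /andP[ab _] /eqP eq_e; rewrite def_e in eq_e.
    have /set2P[] : a \in [set x; y]%SET by rewrite -eq_e set21.
    + move=> ax; have /set2P[] : b \in [set x; y]%SET by rewrite -eq_e set22.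
        by move=> bx; rewrite ax bx adj_irrefl in ab.
      by move=> ->; rewrite ax !eqxx.
    + move=> ay; have /set2P[] : b \in [set x; y]%SET by rewrite -eq_e set22.
        by move=> ->; rewrite ay !eqxx orbT.
      by move=> b_y; rewrite ay b_y adj_irrefl in ab.
  - by rewrite xy -def_e eE eqxx.
  - by rewrite adj_sym xy finset.setUC -def_e eE eqxx.
rewrite (eq_bigl _ _ pairP) (bigD1 (x, y)) ?eqxx //= (big_pred1 (y, x)) ?w_sum //.
move=> p; rewrite andb_orl andbN /= andb_idr // => /eqP->.
by rewrite xpair_eqE (negPf nxy) andbF.
Qed.

(** The edges of a subgraph distribute their weight among its own vertices only, and since shares
    are nonnegative, no vertex gets more than its full load. *)
Lemma mad_le (l : R) : 0 < c -> 0 <= l -> (forall x y, 0 <= w x y) ->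
  (forall x, \sum_(y | adj x y) w x y <= l) -> mad R G <= 2 * l / c.
Proof.
move=> c0 l0 w0 wl; apply: bigmax_le; first by rewrite !mulr_ge0 ?invr_ge0 // ltW.
move=> [V E] /= /andP[/andP[/= sE /'forall_implyP sV] V0]; rewrite /avg_degree /=.
have V_gt0 : (0 : R) < #|V|%:R by rewrite ltr0n card_gt0.
suff: c * #|E|%:R <= l * #|V|%:R.
  by rewrite ler_pdivrMr // mulrAC ler_pdivlMr //; lra.
rewrite -sum_shares //.
rewrite (bigID (mem V)) /= [X in _ + X]big1 ?addr0 => [|x nVx].
  rewrite mulr_natr -sumr_const; apply: ler_sum => x _; apply: le_trans (wl x).
  rewrite [leRHS](bigID (fun y => [set x; y]%SET \in E)) /= lerDl.
  exact: sumr_ge0.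
apply: big_pred0 => y; apply/negP => /andP[_ /(sV _)/fintype.subsetP/(_ x)].
by rewrite set21 (negPf nVx) => /(_ isT).
Qed.

(** The whole graph is a dense enough subgraph; the strict inequality at [x0] makes the total
    strict. *)
Lemma lt_mad (l : R) (x0 : G) : 0 < c ->
  (forall x, l <= \sum_(y | adj x y) w x y) ->
  l < \sum_(y | adj x0 y) w x0 y -> 2 * l / c < mad R G.
Proof.
move=> c0 lw lx0.
have G_gt0 : (0 : R) < #|[set: G]|%:R by rewrite ltr0n; apply/card_gt0P; exists x0.
apply: (@lt_le_trans _ _ (avg_degree R ([set: G], edges G))); last first.
  apply: le_bigmax_cond; apply/andP; split.
    by apply/andP; split=> //; apply/'forall_implyP => e _; apply: finset.subsetT.
  by rewrite -card_gt0; apply/card_gt0P; exists x0.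
rewrite /avg_degree /=; suff: l * #|[set: G]|%:R < c * #|edges G|%:R.
  by rewrite ltr_pdivlMr // mulrAC ltr_pdivrMr //; lra.
rewrite -sum_shares //.
rewrite mulr_natr -sumr_const (bigD1 x0) //= [ltRHS](bigD1 x0) //=.
have edgeE x : \sum_(y | adj x y && ([set x; y]%SET \in edges G)) w x y =
    \sum_(y | adj x y) w x y.
  apply: eq_bigl => y; rewrite andb_idr // => xy.
  by apply: (introT imsetP); exists (x, y); rewrite ?inE.
rewrite edgeE ltr_leD //.
rewrite [leLHS](eq_bigl (fun x => x != x0)) => [|x]; last by rewrite inE.
by apply: ler_sum => x _; rewrite edgeE.
Qed.
End FractionalOrientation.

(** * Connections inside the forest class of a coloring *)

Section Linked.
Variables (G : sgraph) (F : {set G}).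

(** Hiding the membership proofs lets connections compose on vertices of [G] instead of the
    subtype. *)
Definition linked (x y : G) : Prop :=
  exists (hx : x \in F) (hy : y \in F),
    connect (@induced_adj G F) (exist _ x hx) (exist _ y hy).

Lemma linked_refl x : x \in F -> linked x x.
Proof. by move=> hx; exists hx, hx; apply: connect0. Qed.

Lemma linked_adj x y : x \in F -> y \in F -> adj x y -> linked x y.
Proof. by move=> hx hy xy; exists hx, hy; apply: connect1. Qed.

Lemma linked_trans x y z : linked x y -> linked y z -> linked x z.
Proof.
move=> [hx [hy xy]] [hy' [hz yz]]; exists hx, hz.
by apply: connect_trans xy _; rewrite (bool_irrelevance hy hy').
Qed.

Lemma linked_path x p :
  path (@adj G) x p -> {subset x :: p <= F} -> {in x :: p, forall y, linked x y}.
Proof.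
elim: p x => [|z p IHp] x /= => [_ sF y|/andP[xz pz] sF y].
  by rewrite inE => /eqP->; apply/linked_refl/sF; rewrite mem_head.
have Fx : x \in F by apply: sF; rewrite mem_head.
rewrite inE => /predU1P[->|yp]; first exact: linked_refl.
apply: (@linked_trans _ z); last first.
  by apply: IHp => // u up; apply: sF; rewrite inE up orbT.
by apply: linked_adj => //; apply: sF; rewrite !inE eqxx orbT.
Qed.

Lemma leq_card_linked k (I : {set G}) x (D : {set G}) :
  IF_coloring k I F -> {in D, forall y, linked x y} -> (#|D| <= k)%N.
Proof.
move=> [_ _ _ _ cF] lD; have [->|[y /lD[hx _]]] := finset.set_0Vmem D.
  by rewrite cards0.
apply: leq_trans (cF (exist _ x hx)).
apply: (leq_trans _ (leq_imset_card val _)); apply/subset_leq_card/fintype.subsetP.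
move=> z /lD[hx' [hz xz]]; apply/imsetP; exists (exist _ z hz) => //.
by rewrite inE (bool_irrelevance hx hx').
Qed.

Lemma IF_coloring_adj k (I : {set G}) x y :
  IF_coloring k I F -> adj x y -> (x \in F) || (y \in F).
Proof.
move=> [UIF _ iI _ _] xy; apply: contraLR isT; rewrite negb_or => /andP[xF yF].
have inI z : z \notin F -> z \in I.
  by move=> zF; have := finset.in_setT z; rewrite -UIF inE (negPf zF) orbF.
by have := iI x y (inI _ xF) (inI _ yF); rewrite xy.
Qed.

Lemma IF_coloring_triangle k (I : {set G}) x y z :
  IF_coloring k I F -> adj x y -> adj y z -> adj z x ->
  ~~ [&& x \in F, y \in F & z \in F].
Proof.
move=> [_ _ _ fF _] xy yz zx; apply/negP => /and3P[hx hy hz].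
suff Uc : ucycle (@induced_adj G F) [:: exist _ x hx; exist _ y hy; exist _ z hz].
  by have := fF _ Uc.
rewrite /ucycle /= /induced_adj /= xy yz zx /=.
have neq u v : adj u v -> u != v :> G.
  by apply: contraTneq => ->; rewrite adj_irrefl.
by rewrite !inE -!val_eqE /= negb_or (neq x y) // (neq y z) // eq_sym (neq z x).
Qed.
End Linked.

(** * Pendant triangles and their weight in a coloring *)

Section PendantTriangles.
Variables (H : sgraph) (m : H -> nat).

(* The pair (a, b) ranges over the two new vertices, indexed by b, of the
   triangle a hanging at [tag a]. *)
Definition pendant_vertex : finType := (H + {x : H & 'I_(m x)} * bool)%type.

Definition pendant_adj : rel pendant_vertex := fun p q =>
  match p, q with
  | inl x, inl y => adj x y
  | inl x, inr (a, _) | inr (a, _), inl x => tag a == x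
  | inr (a, b), inr (a', b') => (a == a') && (b != b')
  end.

Lemma pendant_adj_sym : symmetric pendant_adj.
Proof.
case=> [x|[a b]] [y|[a' b']] //=; first exact: adj_sym.
by rewrite eq_sym [b == _]eq_sym.
Qed.

Lemma pendant_adj_irrefl : irreflexive pendant_adj.
Proof. by case=> [x|[a b]] /=; rewrite ?adj_irrefl ?eqxx. Qed.

Definition pendant : sgraph := SGraph pendant_adj_sym pendant_adj_irrefl.

Lemma card_pendant_at (s : seq H) : uniq s ->
  #|[pred a : {x : H & 'I_(m x)} | tag a \in s]| = (\sum_(x <- s) m x)%N.
Proof.
move=> us; rewrite -sum1_card (eq_bigl (fun a => (tag a \in s) && true)); last first.
  by move=> a; rewrite inE andbT.
rewrite -(sig_big_dep (fun x => x \in s) (fun _ _ => true) (fun _ _ => 1%N)) /=.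
rewrite big_uniq //=; apply: eq_bigr => x _.
by rewrite sum1_card card_ord.
Qed.

Lemma card_pendant : #|pendant| = (#|H| + 2 * \sum_x m x)%N.
Proof.
rewrite card_sum card_prod card_bool mulnC; congr (_ + _ * _)%N.
rewrite card_tagged sumnE big_map -big_enum /=; apply: eq_bigr => x _.
by rewrite card_ord.
Qed.

(** The two new vertices of a pendant triangle are adjacent, so one of them, chosen by [b], is in
    [F] and joins the component of the path. *)
Lemma path_weight k (I F : {set pendant}) x p : IF_coloring k I F ->
  path (@adj H) x p -> uniq (x :: p) -> {subset x :: p <= [pred y | inl y \in F]} ->
  (\sum_(y <- x :: p) (m y).+1 <= k)%N.
Proof.
move=> cIF xp Up sF.
pose b a := (inr (a, true) : pendant) \in F.
have bF a : (inr (a, b a) : pendant) \in F.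
  have := IF_coloring_adj (x := inr (a, true) : pendant) (y := inr (a, false)) cIF.
  rewrite /= !eqxx => /(_ isT); rewrite /b.
  by case aF: ((inr (a, true) : pendant) \in F).
pose A : {set pendant} := [set inl y | y in [pred y | y \in x :: p]]%SET.
pose D : {set pendant} := [set inr (a, b a) | a in [pred a | tag a \in x :: p]]%SET.
have AD0 : (A :&: D = finset.set0)%SET.
  apply/finset.setP => z; rewrite !inE; apply/negP.
  by case/andP=> /imsetP[y _ ->] /imsetP[a _].
have -> : (\sum_(y <- x :: p) (m y).+1 = #|A :|: D|)%N.
  rewrite cardsU AD0 cards0 subn0 !card_imset => [||y y' []//]; last by move=> a a' [].
  rewrite card_pendant_at // (card_uniqP Up) -sum1_size -big_split /=.
  by apply: eq_bigr => y _; rewrite add1n.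
have lx y : y \in x :: p -> linked F (inl x) (inl y).
  have := @linked_path pendant F (inl x) (map inl p).
  rewrite path_map -map_cons => /(_ xp) lp yp; apply: lp; last exact: map_f.
  by move=> _ /mapP[u up ->]; apply: sF.
apply: (leq_card_linked cIF) => z; rewrite inE => /orP[/imsetP[y yp ->]|/imsetP[a ap ->]].
  exact: lx.
apply: linked_trans (lx _ ap) _; apply: linked_adj => //=; first exact: sF.
Qed.
End PendantTriangles.

(** * Loads in a graph with pendant triangles *)

Section PendantShares.
Variables (R : realFieldType) (H : sgraph) (m : H -> nat).
Variables (B : R) (s : H -> H -> R).

(** A new vertex gets [B + (2 * B - 3)], the critical load, which leaves 6 per triangle for the
    vertex where it hangs. *)
Definition pendant_share (p q : pendant m) : R :=
  match p, q with
  | inl x, inl y => s x y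
  | inl _, inr _ => 3
  | inr _, inl _ => 2 * B - 3
  | inr _, inr _ => B
  end.

Lemma pendant_share_sum : (forall x y, adj x y -> s x y + s y x = 2 * B) ->
  forall p q, adj p q -> pendant_share p q + pendant_share q p = 2 * B.
Proof.
move=> s2B [x|[a b]] [y|[a' b']] //=; first exact: s2B.
- by move=> _; ring.
- by move=> _; ring.
- by move=> _; ring.
Qed.

Lemma pendant_share_ge0 : 3 <= B -> (forall x y, 0 <= s x y) ->
  forall p q, 0 <= pendant_share p q.
Proof. by move=> B3 s0 [x|[a b]] [y|[a' b']] //=; lra. Qed.

Lemma pendant_load_base x :
  \sum_(q | adj (inl x : pendant m) q) pendant_share (inl x) q =
  \sum_(y | adj x y) s x y + 6 * (m x)%:R.
Proof.
rewrite big_sumType /=; congr (_ + _).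
transitivity (\sum_(a : {x : H & 'I_(m x)} | tag a == x) (6 : R)).
  rewrite [RHS](eq_bigr (fun a => \sum_(b : bool) (3 : R))) => [|a _]; last first.
    by rewrite big_bool /=; ring.
  by rewrite pair_big_dep /=; apply: eq_big => [[a b]|[a b]] //=; rewrite andbT.
rewrite sumr_const mulr_natr; congr (_ *+ _).
have := card_pendant_at m (s := [:: x]) isT; rewrite big_seq1 => <-.
by apply: eq_card => a; rewrite !inE.
Qed.

Lemma pendant_load_new p :
  \sum_(q | adj (inr p : pendant m) q) pendant_share (inr p) q = 3 * B - 3.
Proof.
case: p => a b; rewrite big_sumType /= (big_pred1 (tag a)) => [|y]; last first.
  by rewrite eq_sym.
rewrite (big_pred1 (a, ~~ b)) => [|[a' b']]; first by rewrite /=; ring.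
by rewrite /= -[RHS]/((a' == a) && (b' == ~~ b)) eq_sym; case: b b' => [] [].
Qed.
End PendantShares.

(** * The chain of units and its pendant triangles *)

(* The spine consists of the units [5i, ..., 5i + 4]: a triangle t, r, s
   followed by u and v, where s ~ u ~ v and v is joined to the next t. The last
   unit stops at its s. *)
Definition spine_arc (a b : nat) : bool :=
  (b == a.+1) || (b == a.+2) && (a %% 5 == 0)%N.

Definition spine_adj n : rel 'I_(5 * n + 3) :=
  fun x y => spine_arc x y || spine_arc y x.

Lemma spine_adj_sym n : symmetric (@spine_adj n).
Proof. by move=> x y; rewrite /spine_adj orbC. Qed.

Lemma spine_adj_irrefl n : irreflexive (@spine_adj n).
Proof. by move=> x; rewrite /spine_adj /spine_arc; lia. Qed.

Definition spine n : sgraph := SGraph (@spine_adj_sym n) (@spine_adj_irrefl n).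

(** The match lists the sizes of t, r, s, u and v; the vertex itself counts for one, hence the final
    [.-1]. *)
Definition unit_pendants k (j : nat) : nat :=
  (match (j %% 5)%N with 0 | 2 => k./2 | 1 => uphalf k | _ => 1 end).-1.

Definition pendants k n (j : nat) : nat :=
  (unit_pendants k j + (j == 0) + (j == 5 * n + 2))%N.

Definition necklace k n : sgraph := pendant (fun x : spine n => pendants k n x).

(** * Loads along the spine *)

Section SpineShares.
Variables (R : realFieldType) (k : nat).
Hypothesis k_ge2 : (2 <= k)%N.

(* Half of the weight 2B of an edge. It equals 3k - 1 for even k and 3k - 2 for
   odd k, so [mad_bound R k] is 3 - 3 / B. *)
Definition half_weight : R := 2 * (uphalf k)%:R + 4 * (k./2)%:R - 1.
Local Notation B := half_weight.

Lemma half_k_ge1 : 1 <= (k./2)%:R :> R.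
Proof. by rewrite ler1n; lia. Qed.

Lemma uphalf_k_ge1 : 1 <= (uphalf k)%:R :> R.
Proof. by rewrite ler1n; lia. Qed.

Lemma half_weight_ge5 : 5 <= B.
Proof. by have := half_k_ge1; have := uphalf_k_ge1; rewrite /B; lra. Qed.

Variable n : nat.
Hypothesis n_gt0 : (0 < n)%N.

(* Every spine edge but rt and rs moves weight [drift i] to the right, compared
   with the split giving load 3B - 3 to all vertices of an infinite spine. The
   extra triangles at both ends cause an excess of 3 there, whence the
   boundary values 3 and -3; the total decrease 6 is spread over the v's. *)
Definition drift (i : nat) : R := 3 - 6 * i%:R / n%:R.

(** This is the share of [j] in its edge to [j.+1]. A vertex v receives the drift of its own unit
    and passes on that of the next, so it keeps an excess of [6 / n]. *)
Definition right_share (j : nat) : R :=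
  match (j %% 5)%N with
  | 0 => 2 * B - 6 * (k./2)%:R
  | 1 => 6 * (k./2)%:R
  | 2 => 3 - drift (j %/ 5)
  | 3 => B - drift (j %/ 5)
  | _ => 2 * B - 3 - drift (j %/ 5).+1
  end.

Definition spine_share (a b : nat) : R :=
  if b == a.+1 then right_share a else
  if a == b.+1 then 2 * B - right_share b else
  if (a < b)%N then B - drift (a %/ 5) else B + drift (b %/ 5).

Lemma spine_share_sum (x y : spine n) :
  adj x y -> spine_share x y + spine_share y x = 2 * B.
Proof.
rewrite /= /spine_adj /spine_arc /spine_share.
case: (eqVneq (y : nat) x.+1) => [->|yx].
  have -> : (x == x.+2 :> nat) = false by lia.
  by move=> _; ring.
case: (eqVneq (x : nat) y.+1) => [->|xy]; first by move=> _; ring.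
by case: (ltngtP x y) => /= xy'; [move=> _; ring|move=> _; ring|lia].
Qed.

Lemma drift_bound i : (i <= n)%N -> -3 <= drift i <= 3.
Proof.
move=> le_in; have n0 : (0 : R) < n%:R by rewrite ltr0n.
have i1 : i%:R / n%:R <= 1 :> R by rewrite ler_pdivrMr // mul1r ler_nat.
have i0 : 0 <= i%:R / n%:R :> R by rewrite divr_ge0.
by rewrite /drift -mulrA; apply/andP; split; lra.
Qed.

(** The range of the drift is just small enough: 3 keeps the share of s nonnegative, and -3 keeps
    that of v at most [2 * B]. *)
Lemma right_share_bound j : (j.+1 < 5 * n + 3)%N -> 0 <= right_share j <= 2 * B.
Proof.
move=> jn; have := half_k_ge1; have := uphalf_k_ge1; have := half_weight_ge5.
have := @drift_bound (j %/ 5); have := @drift_bound (j %/ 5).+1.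
rewrite /right_share; have := ltn_pmod j (isT : 0 < 5)%N.
have := divn_eq j 5; set c := (j %% 5)%N; set i := (j %/ 5)%N => jE.
by case: c jE => [|[|[|[|[|]]]]] //= jE _ d1 d2; rewrite /B; try (have := d1 ltac:(lia));
  try (have := d2 ltac:(lia)); move=> *; apply/andP; split; lra.
Qed.

Lemma spine_share_ge0 (x y : spine n) : 0 <= spine_share x y.
Proof.
have := half_weight_ge5; have := ltn_ord x; have := ltn_ord y.
rewrite /spine_share; case: eqP => [-> yn _ _|_].
  by have /andP[] := right_share_bound yn.
case: eqP => [-> _ xn _|_ yn xn].
  by have := right_share_bound xn; lra.
have := @drift_bound (x %/ 5); have := @drift_bound (y %/ 5).
move=> /(_ ltac:(lia)) ? /(_ ltac:(lia)) ? ?.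
by case: ifP => _; lra.
Qed.

Lemma spine_load_split (x : spine n) :
  \sum_(y : spine n | adj x y) spine_share x y =
    (if (x.+1 < 5 * n + 3)%N then right_share x else 0)
  + (if (0 < x)%N then 2 * B - right_share x.-1 else 0)
  + (if (x %% 5 == 0)%N then B - drift (x %/ 5) else 0)
  + (if (x %% 5 == 2)%N then B + drift (x %/ 5) else 0).
Proof.
(* Each optional term becomes a sum over all vertices with at most one nonzero entry, so the
   identity can be checked for each [y] separately. *)
have delta (P : bool) (j : nat) (v : R) : (P -> j < 5 * n + 3)%N ->
    (if P then v else 0) = \sum_(y < 5 * n + 3) (if P && (y == j :> nat) then v else 0).
  case: P => /= [/(_ isT) jn|_]; last by rewrite big1.
  by rewrite -big_mkcond (big_ord1_eq _ (fun=> v)) jn.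
have xn := ltn_ord x.
rewrite (delta _ x.+1) // (delta (0 < x)%N x.-1); last by lia.
rewrite (delta (x %% 5 == 0)%N x.+2); last by lia.
rewrite (delta (x %% 5 == 2)%N x.-2); last by lia.
rewrite -!big_split big_mkcond /=; apply: eq_bigr => y _; have yn := ltn_ord y.
rewrite /spine_adj /spine_arc /spine_share.
case: (eqVneq (y : nat) x.+1) => [yx|yx] /=.
  have -> : (x.+1 < 5 * n + 3)%N by lia.
  have -> : (y == x.-1 :> nat) = false by lia.
  have -> : (y == x.+2 :> nat) = false by lia.
  have -> : (x %% 5 == 2)%N && (y == x.-2 :> nat) = false by lia.
  by rewrite !andbF !addr0.
rewrite andbF add0r; case: (eqVneq (x : nat) y.+1) => [xy|xy] /=.
  have -> : (0 < x)%N by lia.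
  have -> : (y == x.-1 :> nat) by lia.
  have -> : (y == x.+2 :> nat) = false by lia.
  have -> : (x %% 5 == 2)%N && (y == x.-2 :> nat) = false by lia.
  by rewrite orbT !andbF !addr0 xy.
have -> : (0 < x)%N && (y == x.-1 :> nat) = false by lia.
rewrite add0r; case: (ltnP x y) => xy'.
  have -> : (x %% 5 == 2)%N && (y == x.-2 :> nat) = false by lia.
  have -> : (x == y.+2 :> nat) = false by lia.
  by rewrite orbF addr0 andbC.
have -> : (y == x.+2 :> nat) = false by lia.
rewrite andbF add0r /=.
have -> : (x == y.+2 :> nat) && (y %% 5 == 0)%N = (x %% 5 == 2)%N && (y == x.-2 :> nat) by lia.
case: andP => // -[x2 /eqP yE]; congr (_ + drift _); lia.
Qed.

(** Only the vertices v exceed the critical load. At the two ends, drift 3 and -3 make the share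
    lost with the missing edge equal to 6, which the extra triangle restores. *)
Lemma spine_load (x : spine n) :
  \sum_(y : spine n | adj x y) spine_share x y + 6 * (pendants k n x)%:R =
  3 * B - 3 + (if (x %% 5 == 4)%N then 6 / n%:R else 0).
Proof.
rewrite spine_load_split; have xn := ltn_ord x.
have n0 : (n%:R : R) != 0 by rewrite pnatr_eq0; lia.
have predR q : (0 < q)%N -> (q.-1)%:R = q%:R - 1 :> R.
  by case: q => // q _; rewrite -[in RHS]addn1 natrD addrK.
have hp : (k./2.-1)%:R = (k./2)%:R - 1 :> R by apply: predR; lia.
have gp : ((uphalf k).-1)%:R = (uphalf k)%:R - 1 :> R by apply: predR; lia.
have modE i c : (c < 5 -> (5 * i + c) %% 5 = c)%N by lia.
have divE i c : (c < 5 -> (5 * i + c) %/ 5 = i)%N by lia.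
have : exists i c, (x = 5 * i + c :> nat)%N /\ (c < 5)%N.
  by exists (x %/ 5)%N, (x %% 5)%N; lia.
case=> i [c [xE c5]]; rewrite /right_share /pendants /unit_pendants !natrD xE.
case: c c5 xE => [|[|[|[|[|]]]]] // _ xE; rewrite ?modE ?divE //=.
- have -> : ((5 * i + 0).+1 < 5 * n + 3)%N by lia.
  have -> : (5 * i + 0 == 5 * n + 2)%N = false by lia.
  case: i xE => [|i] xE.
    by rewrite /= /drift hp /B; field.
  have -> : (5 * i.+1 + 0).-1 = (5 * i + 4)%N by lia.
  by rewrite modE // divE //= hp /B; field.
- have -> : ((5 * i + 1).+1 < 5 * n + 3)%N by lia.
  have -> : (5 * i + 1 == 5 * n + 2)%N = false by lia.
  have -> : (0 < 5 * i + 1)%N by lia.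
  have -> : (5 * i + 1 == 0)%N = false by lia.
  have -> : (5 * i + 1).-1 = (5 * i + 0)%N by lia.
  by rewrite modE // gp /B !mulr0n; ring.
- have -> : (0 < 5 * i + 2)%N by lia.
  have -> : (5 * i + 2 == 0)%N = false by lia.
  have -> : (5 * i + 2).-1 = (5 * i + 1)%N by lia.
  rewrite modE // hp; case: (eqVneq i n) => [->|ni].
    have -> : ((5 * n + 2).+1 < 5 * n + 3)%N = false by lia.
    by rewrite eqxx /drift /B mulr0n mulr1n; field.
  have -> : ((5 * i + 2).+1 < 5 * n + 3)%N by lia.
  have -> : (5 * i + 2 == 5 * n + 2)%N = false by lia.
  by rewrite /B !mulr0n; ring.
- have -> : ((5 * i + 3).+1 < 5 * n + 3)%N by lia.
  have -> : (5 * i + 3 == 5 * n + 2)%N = false by lia.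
  have -> : (0 < 5 * i + 3)%N by lia.
  have -> : (5 * i + 3 == 0)%N = false by lia.
  have -> : (5 * i + 3).-1 = (5 * i + 2)%N by lia.
  by rewrite modE // divE // !mulr0n; ring.
- have -> : ((5 * i + 4).+1 < 5 * n + 3)%N by lia.
  have -> : (5 * i + 4 == 5 * n + 2)%N = false by lia.
  have -> : (0 < 5 * i + 4)%N by lia.
  have -> : (5 * i + 4 == 0)%N = false by lia.
  have -> : (5 * i + 4).-1 = (5 * i + 3)%N by lia.
  by rewrite modE // divE // /drift -natr1 !mulr0n; field.
Qed.
End SpineShares.

(** * Maximum average degree of the necklaces *)

Lemma mad_boundE (R : realFieldType) k : (2 <= k)%N ->
  mad_bound R k = 2 * (3 * half_weight R k - 3) / (2 * half_weight R k).
Proof.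
move=> k2; have B5 := half_weight_ge5 R k2.
have kE : k%:R = (k./2)%:R + (uphalf k)%:R :> R by rewrite -natrD; congr _%:R; lia.
have -> : mad_bound R k = 3 - 3 / half_weight R k.
  rewrite /mad_bound kE; case: ifP => k_odd; congr (3 - 3 / _); rewrite /half_weight.
    have -> : uphalf k = (k./2).+1 by lia.
    by rewrite -natr1; ring.
  have -> : uphalf k = k./2 by lia.
  by ring.
by field; lra.
Qed.

Lemma lt_mad_necklace (R : realFieldType) k n : (2 <= k)%N -> (0 < n)%N ->
  mad_bound R k < mad R (necklace k n).
Proof.
move=> k2 n0; have B5 := half_weight_ge5 R k2.
(* Vertex 4 is the v of the first unit, where the load is strictly above critical. *)
have x0P : (4 < 5 * n + 3)%N by lia.
have six : 0 < 6 / n%:R :> R by rewrite divr_gt0 ?ltr0n.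
rewrite mad_boundE //.
pose w := pendant_share (m := fun x : spine n => pendants k n x)
  (half_weight R k) (fun x y => spine_share R k n x y).
apply: (@lt_mad _ (necklace k n) w _ _ _ (inl (Ordinal x0P))).
- exact/pendant_share_sum/spine_share_sum.
- by lra.
- move=> [x|p]; last by rewrite pendant_load_new.
  by rewrite pendant_load_base spine_load // lerDl; case: ifP => // _; apply: ltW.
- by rewrite pendant_load_base spine_load //= ltrDl.
Qed.

Lemma mad_necklace_le (R : realFieldType) k n : (2 <= k)%N -> (0 < n)%N ->
  mad R (necklace k n) <= mad_bound R k + 6 / n%:R.
Proof.
move=> k2 n0; have B5 := half_weight_ge5 R k2.
have six : 0 < 6 / n%:R :> R by rewrite divr_gt0 ?ltr0n.
apply: (@le_trans _ _ (2 * (3 * half_weight R k - 3 + 6 / n%:R) / (2 * half_weight R k))).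
  pose w := pendant_share (m := fun x : spine n => pendants k n x)
    (half_weight R k) (fun x y => spine_share R k n x y).
  apply: (@mad_le _ (necklace k n) w); [|lra|lra| |].
  - exact/pendant_share_sum/spine_share_sum.
  - apply: pendant_share_ge0; first lra.
    by move=> x y; apply: spine_share_ge0.
  move=> [x|p]; last by rewrite pendant_load_new lerDl ltW.
  by rewrite pendant_load_base spine_load // lerD2l; case: ifP => // _; apply: ltW.
(* The excess load [6 / n] raises the bound by [6 / n] divided by [half_weight R k], which is at
   least 5. *)
rewrite mad_boundE // ler_pdivrMr; last by lra.
rewrite [leRHS]mulrDl divfK; last by lra.
by nra.
Qed.

(** * Distinct necklaces have distinct sizes *)

Lemma card_necklace k n : #|necklace k n| =
  (5 * n + 3 + 2 * (2 + \sum_(x < 5 * n + 3) unit_pendants k x))%N.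
Proof.
rewrite card_pendant card_ord; congr (_ + 2 * _)%N.
have sum_eq (j : nat) : (j < 5 * n + 3)%N -> (\sum_(x < 5 * n + 3) (x == j :> nat) = 1)%N.
  move=> jn; have := big_ord1_eq addn (fun=> 1%N) j (5 * n + 3).
  by rewrite jn big_mkcond.
by rewrite /pendants !big_split /= !sum_eq; lia.
Qed.

(** The spine grows strictly with [n] and the number of pendant triangles does not decrease. *)
Lemma necklace_inj k : injective (fun n => #|necklace k n|).
Proof.
move=> n n' /=; rewrite !card_necklace => nn'.
wlog le_nn' : n n' nn' / (n <= n')%N.
  by move=> IH; case: (leqP n n') => [/IH->//|/ltnW/IH->].
have : (\sum_(x < 5 * n + 3) unit_pendants k x <=
        \sum_(x < 5 * n' + 3) unit_pendants k x)%N.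
  rewrite -!(big_mkord xpredT (unit_pendants k)).
  by rewrite (@big_cat_nat _ _ _ (5 * n + 3) 0 (5 * n' + 3)) ?leq_addr //; lia.
by move=> ?; lia.
Qed.

(** * Non-colorability by propagation along the chain *)

Lemma necklace_not_colorable k n : (2 <= k)%N -> ~ IF_colorable k (necklace k n).
Proof.
move=> k2 [I [F cIF]].
(* Membership in [F] is read on natural numbers, and is false beyond the spine, so that adjacency
   reduces to arithmetic. *)
pose inF (a : nat) := [exists x : spine n, (x == a :> nat) && ((inl x : necklace k n) \in F)].
have weight_le s : all inF s ->
    path.sorted (fun a b => spine_arc a b || spine_arc b a) s -> uniq s ->
    (\sum_(a <- s) (pendants k n a).+1 <= k)%N.
  move=> sF ss us.
  have [s' s'E s'F] : exists2 s' : seq (spine n), s = map val s' &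
      {subset s' <= [pred x | (inl x : necklace k n) \in F]}.
    elim: s sF {ss us} => [|a s IHs] /=; first by exists [::].
    case/andP=> /existsP[x /andP[/eqP <- xF]] /IHs[s' -> s'F].
    by exists (x :: s') => // y; rewrite inE => /predU1P[->|/s'F].
  rewrite {}s'E in ss us *; rewrite big_map; rewrite (map_inj_uniq val_inj) in us.
  case: s' => [|x p] in ss us s'F *; first by rewrite big_nil.
  apply: (path_weight (m := fun x : spine n => pendants k n x) cIF _ us s'F).
  by move: ss; rewrite /= path_map.
have edge a b : spine_arc a b -> (b < 5 * n + 3)%N -> inF a || inF b.
  move=> ab bn; have an : (a < 5 * n + 3)%N by move: ab; rewrite /spine_arc; lia.
  have := IF_coloring_adj (x := inl (Ordinal an) : necklace k n) (y := inl (Ordinal bn)) cIF.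
  rewrite /= /spine_adj /= ab => /(_ isT)/orP[xF|yF]; apply/orP.
    by left; apply/existsP; exists (Ordinal an); rewrite /= eqxx.
  by right; apply/existsP; exists (Ordinal bn); rewrite /= eqxx.
have triangle i : ~~ [&& inF (5 * i)%N, inF (5 * i + 1)%N & inF (5 * i + 2)%N].
  apply/negP => /and3P[/existsP[x /andP[/eqP xE xF]] /existsP[y /andP[/eqP yE yF]]
    /existsP[z /andP[/eqP zE zF]]].
  have := IF_coloring_triangle (x := inl x : necklace k n) (y := inl y) (z := inl z) cIF.
  rewrite xF yF zF /= /spine_adj /spine_arc xE yE zE => H.
  by have /negP[] := H ltac:(lia) ltac:(lia) ltac:(lia).
have hg : (k = k./2 + uphalf k)%N by lia.
have wt i : (k./2 + (i == 0) <= (pendants k n (5 * i)).+1)%N.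
  rewrite /pendants /unit_pendants; have -> : (5 * i %% 5 = 0)%N by lia.
  by lia.
have wr i : (uphalf k <= (pendants k n (5 * i + 1)).+1)%N.
  rewrite /pendants /unit_pendants; have -> : ((5 * i + 1) %% 5 = 1)%N by lia.
  by lia.
have ws i : (k./2 + (i == n) <= (pendants k n (5 * i + 2)).+1)%N.
  rewrite /pendants /unit_pendants; have -> : ((5 * i + 2) %% 5 = 2)%N by lia.
  by lia.
have step i : (i <= n)%N -> ((0 < i)%N -> inF (5 * i).-1) ->
    (i < n)%N /\ ~~ inF (5 * i + 3)%N.
  move=> le_in prevF.
  (* In the last unit, the extra triangle at s acts as a following u in [F]; both cases are refuted
     together. *)
  suff post : ~~ ((i == n) || inF (5 * i + 3)%N).
    by move: post; rewrite negb_or => /andP[ni ->]; split => //; lia.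
  apply/negP => postF; have := triangle i; have := edge (5 * i)%N (5 * i + 1)%N.
  have := edge (5 * i)%N (5 * i + 2)%N; have := edge (5 * i + 1)%N (5 * i + 2)%N.
  rewrite /spine_arc => /(_ ltac:(lia) ltac:(lia)) rs /(_ ltac:(lia) ltac:(lia)) ts.
  move=> /(_ ltac:(lia) ltac:(lia)) tr tri.
  have := wt i; have := wr i; have := ws i => wsi wri wti.
  (* If t is not in [F], then r and s are and already weigh [k]; u or the extra triangle is one too
     many. *)
  case tF: (inF (5 * i)%N) in ts tr tri; last first.
    rewrite /= in ts tr; case/orP: postF => [/eqP iE|uF].
      have := weight_le [:: 5 * i + 1; 5 * i + 2]%N.
      by rewrite !big_cons big_nil /= ts tr /spine_arc !inE; lia.
    have := weight_le [:: 5 * i + 1; 5 * i + 2; 5 * i + 3]%N.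
    by rewrite !big_cons big_nil /= ts tr uF /spine_arc !inE; lia.
  (* If t and r are in [F], they weigh [k], and the preceding v or the first extra triangle is one
     too many. *)
  case rF: (inF (5 * i + 1)%N) in rs tri.
    case: (posnP i) => i0.
      have := weight_le [:: 5 * i; 5 * i + 1]%N.
      by rewrite !big_cons big_nil /= tF rF /spine_arc !inE; lia.
    have := weight_le [:: (5 * i).-1; 5 * i; 5 * i + 1]%N.
    by rewrite !big_cons big_nil /= tF rF prevF // /spine_arc !inE; lia.
  (* Now t and s are in [F], and with one more at either end the weight is at least [2 * k./2 + 2],
     which exceeds [k]. *)
  rewrite /= in rs.
  case/orP: postF => [/eqP iE|uF]; case: (posnP i) => i0.
  - have := weight_le [:: 5 * i; 5 * i + 2]%N.
    by rewrite !big_cons big_nil /= tF rs /spine_arc !inE; lia.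
  - have := weight_le [:: (5 * i).-1; 5 * i; 5 * i + 2]%N.
    by rewrite !big_cons big_nil /= tF rs prevF // /spine_arc !inE; lia.
  - have := weight_le [:: 5 * i; 5 * i + 2; 5 * i + 3]%N.
    by rewrite !big_cons big_nil /= tF rs uF /spine_arc !inE; lia.
  - have := weight_le [:: (5 * i).-1; 5 * i; 5 * i + 2; 5 * i + 3]%N.
    by rewrite !big_cons big_nil /= tF rs uF prevF // /spine_arc !inE; lia.
(* As u is not in [F], its neighbor v is; the chain starts without a premise at [i = 0]. *)
have prev i : (i <= n)%N -> (0 < i)%N -> inF (5 * i).-1.
  elim: i => [//|i IHi] le_in _.
  have [_ uF] := step i (ltnW le_in) (IHi (ltnW le_in)).
  have -> : (5 * i.+1).-1 = (5 * i + 4)%N by lia.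
  have := edge (5 * i + 3)%N (5 * i + 4)%N; rewrite (negPf uF) /=.
  by apply; rewrite /spine_arc; lia.
by have [] := step n (leqnn n) (prev n (leqnn n)); rewrite ltnn.
Qed.

Local Open Scope classical_set_scope.

Theorem mainTheorem3 (R : realType) (k : nat) (hk : (2 <= k)%N) :
  exists G : nat -> sgraph,
    [/\ forall s t : nat, s <> t -> ~ isomorphic (G s) (G t),
        forall t : nat, mad_bound R k < mad R (G t),
        (fun t : nat => mad R (G t)) @ \oo --> mad_bound R k &
        forall t : nat, ~ IF_colorable k (G t)].
Proof.
(* The shift to [t.+1] makes the number of units positive and turns the error [6 / n] into
   [6 * harmonic t]. *)
exists (fun t => necklace k t.+1); split=> [s t st [f bij_f _]|t||t].
- by have /(@necklace_inj k)[] := bij_eq_card bij_f.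
- exact: lt_mad_necklace.
- apply: (@squeeze_cvgr _ _ _ _ (fun=> mad_bound R k)
    (fun t => mad_bound R k + 6 * harmonic t)); [|exact: cvg_cst|].
    apply: nearW => t; rewrite ltW ?lt_mad_necklace //=.
    exact: mad_necklace_le.
  rewrite -[X in _ --> X]addr0 -(mulr0 (6 : R)).
  by apply: cvgD; [exact: cvg_cst|apply: cvgMr; exact: cvg_harmonic].
- exact: necklace_not_colorable.
Qed.
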